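(* Let $S$ be a Hausdorff topological semigroup whose square $S\times S$ is pseudocompact. Then $S$ is a topological paragroup if and only if $S$ is simple and contains an idempotent.
   Context: All topological spaces are Hausdorff and all semigroups are nonempty. A topological semigroup is a topological space with a jointly continuous associative binary operation. A semigroup $S$ is simple if it contains no proper (nonempty) two-sided ideal. A space $X$ is pseudocompact if $X$ is Tychonoff and each continuous real-valued function on $X$ is bounded. For a group $H$, sets $X,Y$ and a map $\sigma:Y\times X\to H$, the Rees product $[X,H,Y]_\sigma$ is the set $X\times H\times Y$ with the operation $(x,h,y)\cdot(x',h',y')=(x,h\,\sigma(y,x')\,h',y')$. A topological paragroup is a topological semigroup that is topologically isomorphic (isomorphic via a homeomorphism) to a Rees product $[X,H,Y]_\sigma$ with the product topology, where $X,Y$ are topological spaces, $H$ is a topological group (multiplication and inversion continuous) and $\sigma:Y\times X\to H$ is continuous. *)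

(* Defs.v *)
From HB Require Import structures.
From mathcomp Require Import all_boot all_order all_algebra.
From mathcomp Require Import all_classical all_reals all_analysis.

Set Implicit Arguments.
Unset Strict Implicit.
Unset Printing Implicit Defensive.

Import numFieldNormedType.Exports.

Local Open Scope classical_set_scope.
Local Open Scope group_scope.

(* Separation axioms and nonemptiness are not bundled in the structures below:
   they appear as explicit hypotheses wherever they are assumed. *)

HB.mixin Record isTopologicalSemigroup S & Topological S & Semigroup S := {
  mulg_continuous : continuous (fun p : S * S => p.1 * p.2)
}.

#[short(type="topologicalSemigroupType")]
HB.structure Definition TopologicalSemigroup :=
  {S of Topological S & Semigroup S & isTopologicalSemigroup S}.

HB.mixin Record isTopologicalGroup G & Topological G & Group G := {
  invg_continuous : continuous (fun x : G => x^-1)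
}.

#[short(type="topologicalGroupType")]
HB.structure Definition TopologicalGroup :=
  {G of TopologicalSemigroup G & Group G & isTopologicalGroup G}.

Definition two_sided_ideal (S : semigroupType) (I : set S) : Prop :=
  I !=set0 /\ forall s x : S, I x -> I (s * x) /\ I (x * s).

Definition simple_semigroup (S : semigroupType) : Prop :=
  forall I : set S, two_sided_ideal I -> I = [set: S].

Definition idempotent_element (S : semigroupType) (e : S) : Prop := e * e = e.

(* By [uniform_separatorP], [completely_regular_space] amounts to separating
   points from closed sets by continuous functions into the unit interval. *)
Definition tychonoff_space (T : topologicalType) : Prop :=
  hausdorff_space T /\ completely_regular_space T.

Definition pseudocompact_space (R : realType) (T : topologicalType) : Prop :=
  tychonoff_space T /\ forall f : T -> R, continuous f -> bounded_fun f.

(* [rees sigma] is the Rees product [X, H, Y]_sigma; it is an alias of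
   [X * H * Y] because the product type must not inherit a componentwise
   multiplication. *)
Definition rees (X Y : Type) (H : groupType) (sigma : Y * X -> H) : Type :=
  (X * H * Y)%type.

Section ReesSemigroup.
Variables (X Y : choiceType) (H : groupType) (sigma : Y * X -> H).

HB.instance Definition _ := Choice.copy (rees sigma) (X * H * Y)%type.

Definition rees_mul (p q : rees sigma) : rees sigma :=
  let: (x, h, y) := p in let: (x', h', y') := q in
  (x, h * sigma (y, x') * h', y').

Lemma rees_mulA : associative rees_mul.
Proof. by move=> [[x h] y] [[x' h'] y'] [[x2 h2] y2]; rewrite /= !mulgA. Qed.

HB.instance Definition _ := isSemigroup.Build (rees sigma) rees_mulA.

End ReesSemigroup.

HB.instance Definition _ (X Y : topologicalType) (H : topologicalGroupType)
    (sigma : Y * X -> H) :=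
  Topological.copy (rees sigma) (X * H * Y)%type.

Definition topological_paragroup (S : topologicalSemigroupType) : Prop :=
  exists (X Y : topologicalType) (H : topologicalGroupType)
         (sigma : Y * X -> H),
    [/\ hausdorff_space X, hausdorff_space Y, hausdorff_space H,
        continuous sigma &
        exists (f : S -> rees sigma) (g : rees sigma -> S),
          [/\ {morph f : a b / a * b}, cancel f g, cancel g f,
              continuous f & continuous g]].

(* Main.v *)
(* Pseudocompactness of S * S enters through one fact: for a continuous
   f : S -> R, the pseudometric d_f(x, x') = sup_y |f(xy) - f(x'y)| is
   continuous, and hence S is totally bounded for d_f.

   Let e be idempotent.  If a, b in eSe satisfy ab = e, two powers a^n and
   a^(n+k) are d_f-close; multiplying by b^n shows that f(z) is close to
   f(a^k z) on eSe, and z = e, z = ba give f(ba) = f(e), since a^k ba = a^k.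
   So ba = e, and as S is simple every element of eSe is invertible.  Inversion
   is continuous at x0 because f(x0^-1 x y) and f(x0^-1 x0 y) are close for x
   near x0, uniformly in y; take y = x^-1.  The usual Rees coordinates
   s |-> (s e (ese)^-1, ese, (ese)^-1 e s) are then a homeomorphism. *)
Require Import Defs.
From HB Require Import structures.
From mathcomp Require Import all_boot all_order all_algebra.
From mathcomp Require Import all_classical all_reals all_analysis.
From mathcomp Require Import lra.

Set Implicit Arguments.
Unset Strict Implicit.
Unset Printing Implicit Defensive.

Import Order.TTheory GRing.Theory Num.Theory.
Import numFieldNormedType.Exports.

Local Open Scope classical_set_scope.
Local Open Scope ring_scope.

(** * Feeble compactness of pseudocompact spaces *)

(** A sequential form of: every locally finite family of nonempty open sets is finite. The marked
    points [x n] keep the interiors nonempty. *)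
Definition feebly_compact (T : topologicalType) : Prop :=
  forall (x : nat -> T) (U : nat -> set T), (forall n, nbhs (x n) (U n)) ->
  exists p : T, forall N, nbhs p N ->
  forall n, exists2 m, (n <= m)%N & N `&` U m !=set0.

Lemma completely_regular_bump (R : realType) (T : topologicalType)
    (x : T) (U : set T) :
  completely_regular_space T -> nbhs x U ->
  exists f : T -> R, [/\ continuous f, forall y, 0 <= f y, f x = 1 &
    forall y, ~ U y -> f y = 0].
Proof.
move=> crT xU.
have cB : closed (~` U^°) by apply: open_closedC; exact: open_interior.
have /(crT _ _ cB)/uniform_separatorP-/(_ R)[f [fc f01 fx fB]] : ~ (~` U^°) x.
  by apply.
exists (fun y => 1 - f y); split.
- by move=> y; apply: cvgB; [exact: cvg_cst | exact: fc].
- move=> y; have : f y \in `[0, 1] by apply: f01; exists y.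
  by rewrite in_itv /= subr_ge0 => /andP[].
- by rewrite (fx (f x)) ?subr0//; exists x.
- move=> y Uy; rewrite (fB (f y)) ?subrr//; exists y => //= /interior_subset.
  exact: Uy.
Qed.

Lemma completely_regular_left_factor (R : realType) (X Y : topologicalType)
    (y : Y) :
  completely_regular_space (X * Y)%type -> completely_regular_space X.
Proof.
move=> crXY x B cB Bx.
apply/(@uniform_separatorP _ R).
have /crXY : closed (fst @^-1` B : set (X * Y)).
  by apply: preimage_closed => // ? _; exact: cvg_fst.
move=> /(_ (x, y) Bx)/(@uniform_separatorP _ R)[f [fc f01 fx fB]].
exists (fun a => f (a, y)); split.
- move=> a; apply: (@continuous_comp _ _ _ (fun a => (a, y))); last exact: fc.
  by apply: cvg_pair; [exact: cvg_id | exact: cvg_cst].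
- by move=> _ [a _ <-]; apply: f01; exists (a, y).
- by move=> _ [_ -> <-]; apply: fx; exists (x, y).
- by move=> _ [b Bb <-]; apply: fB; exists (b, y).
Qed.

(** If the sets [U m] were locally finite, the sum of [m] times a bump of height 1 at [x m]
    supported in [U m] would be continuous and unbounded. *)
Lemma pseudocompact_feebly_compact (R : realType) (T : topologicalType) :
  pseudocompact_space R T -> feebly_compact T.
Proof.
move=> [[_ crT] bT] x U xU; apply: contrapT => ncl.
have /choice[n nP] : forall p : T, exists n, exists2 N, nbhs p N &
    forall m, (n <= m)%N -> N `&` U m = set0.
  move=> p; apply: contrapT => np; apply: ncl; exists p => N pN n.
  apply: contrapT => nm; apply: np; exists n, N => // m nm'.
  by apply: contrapT => /eqP/set0P NU; apply: nm; exists m.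
have /choice[f fP] : forall m, exists f : T -> R, [/\ continuous f,
    forall y, 0 <= f y, f (x m) = 1 & forall y, ~ U m y -> f y = 0].
  by move=> m; exact: completely_regular_bump.
pose g k p := \sum_(i < k) i%:R * f i p.
have gE p q k : (n p <= k)%N -> (forall m, (n p <= m)%N -> f m q = 0) ->
    g k q = g (n p) q.
  move=> pk fq; rewrite /g -!(big_mkord xpredT (fun i => i%:R * f i q)).
  rewrite (big_cat_nat (leq0n _) pk)/= (big_nat_cond _ _ (n p) k).
  rewrite (big1 _ (fun i => _ && true)) ?addr0// => i /andP[/andP[ni _] _].
  by rewrite fq ?mulr0.
have fN p : \forall q \near p, forall m, (n p <= m)%N -> f m q = 0.
  have [N pN NU] := nP p; apply: filterS pN => q Nq m nm.
  have [_ _ _ ->//] := fP m; move=> Uq.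
  by have : set0 q by rewrite -(NU _ nm).
(* [F] is the full locally finite sum: all terms from index [n p] on vanish near [p], so one partial
   sum computes [F] on a whole neighborhood. *)
pose F p := g (n p) p.
have FE p : \forall q \near p, g (n p) q = F q.
  near=> q; have fq : forall m, (n p <= m)%N -> f m q = 0 by near: q; exact: fN.
  have fqq : forall m, (n q <= m)%N -> f m q = 0.
    by apply: nbhs_singleton (fN q).
  rewrite -(gE p q (maxn (n p) (n q))) ?leq_maxl//.
  by rewrite (gE q q) ?leq_maxr.
have gc k : continuous (g k).
  move=> p; elim: k => [|k IH].
    rewrite (_ : g 0 = cst 0); first exact: cvg_cst.
    by apply/funext => q; rewrite /g big_ord0.
  rewrite (_ : g k.+1 = (fun q => g k q + k%:R * f k q)).
    have [fc _ _ _] := fP k.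
    by apply: cvgD => //; apply: cvgM; [exact: cvg_cst | exact: fc].
  by apply/funext => q; rewrite /g big_ord_recr.
have Fc : continuous F.
  move=> p; apply: (@cvg_trans _ (g (n p) @ p)); last exact: gc.
  exact: near_eq_cvg (FE p).
have FF : ProperFilter (globally [set: T]).
  exact: (@globally_properfilter _ _ (x 0)).
have /ex_bound[M FM] := bT F Fc.
have [m Mm] : exists m, M < m%:R by exists (Num.truncn M).+1; exact: truncnS_gt.
have [_ fm0 fmx _] := fP m.
(* The [m]-th bump equals 1 at [x m], so its term is not cut off and contributes [m] to
   [F (x m)]. *)
have mn : (m < n (x m))%N.
  rewrite ltnNge; apply/negP => nm.
  have := nbhs_singleton (fN (x m)) _ nm.
  by rewrite fmx => /eqP; rewrite oner_eq0.
have : `|F (x m)| <= M by exact: FM.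
apply/negP; rewrite -ltNge; apply: lt_le_trans Mm _.
apply: le_trans (ler_norm _); rewrite /F /g (bigD1 (Ordinal mn))//= fmx mulr1.
rewrite lerDl sumr_ge0// => i _; rewrite mulr_ge0//.
by have [_ + _ _] := fP i; apply.
Unshelve. all: by end_near. Qed.

(** * Feebly compact products and equicontinuity *)

Lemma feebly_compact_fst (X Y : topologicalType) (y0 : Y) :
  feebly_compact (X * Y)%type -> feebly_compact X.
Proof.
move=> fc x U xU.
have [|[p q] pP] := fc (fun n => (x n, y0)) (fun n => U n `*` setT).
  by move=> n; exists (U n, setT) => //; split; [exact: xU | exact: filterT].
exists p => N pN n; have pN' : nbhs (p, q) (N `*` setT).
  by exists (N, setT) => //; split; [exact: pN | exact: filterT].
have [m nm [[a b] [[Na _] [Ua _]]]] := pP _ pN' n.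
by exists m => //; exists a.
Qed.

(* Otherwise one finds boxes U_n * V_n and neighborhoods W_n of x0 containing all
   later U_m, with |f(u, v) - f(w, v)| >= eps / 2 on U_n * V_n * W_n: impossible
   near a cluster point of the boxes, taking u in U_n, v in V_n and w in U_m. *)
Lemma feebly_compact_equicontinuous (R : realType) (X Y : topologicalType)
    (f : X * Y -> R) (x0 : X) (eps : R) :
  feebly_compact (X * Y)%type -> continuous f -> 0 < eps ->
  \forall x \near x0, forall y, `|f (x, y) - f (x0, y)| < eps.
Proof.
move=> fcXY fc eps0; apply: contrapT => nx0.
have close (p : X * Y) (d : R) : 0 < d ->
    exists U V, [/\ nbhs p.1 U, nbhs p.2 V &
      forall u v, U u -> V v -> `|f (u, v) - f p| < d].
  move=> d0.
  have [[U V] [/= pU pV] UV] : nbhs p [set q | `|f q - f p| < d].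
    have /cvgrPdist_lt/(_ _ d0) := fc p.
    by apply: filterS => q /=; rewrite distrC.
  by exists U, V; split => // u v Uu Vv; exact: (UV (u, v)).
have step (N : set X) : exists D : set X * set Y * set X * (X * Y),
    open_nbhs x0 N -> [/\ nbhs D.2.1 D.1.1.1, nbhs D.2.2 D.1.1.2,
     open_nbhs x0 D.1.2, D.1.1.1 `|` D.1.2 `<=` N &
     forall u v w, D.1.1.1 u -> D.1.1.2 v -> D.1.2 w ->
       eps / 2 <= `|f (u, v) - f (w, v)|].
  have [oN|nN] := pselect (open_nbhs x0 N); last first.
    (* A junk value for [D] still needs a point of [X * Y]; if there is none, the lemma holds
       vacuously. *)
    case: (pselect (exists z : X * Y, True)) => [[z _]|nz].
      by exists (setT, setT, setT, z).
    exfalso; apply: nx0; near=> x => y; exfalso; apply: nz.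
    by exists (x, y).
  have [x [Nx [y xy]]] : exists x, N x /\ exists y,
      eps <= `|f (x, y) - f (x0, y)|.
    apply: contrapT => nN; apply: nx0.
    apply: filterS (open_nbhs_nbhs oN) => x Nx y.
    rewrite ltNge; apply/negP => xy; apply: nN.
    by exists x; split => //; exists y.
  have e8 : 0 < eps / 8 by lra.
  have [U [V [xU yV UV]]] := close (x, y) _ e8.
  have [W [V' [x0W yV' WV]]] := close (x0, y) _ e8.
  exists (U `&` N, V `&` V', W^° `&` N, (x, y)) => _; split => /=.
  - apply: filterI => //; apply: open_nbhs_nbhs; split=> //; exact: (proj1 oN).
  - exact: filterI.
  - by apply: open_nbhsI => //; split => //; exact: open_interior.
  - by move=> ? [] [].
  - move=> u v w [Uu _] [Vv V'v] [/interior_subset Ww _].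
    have := UV _ _ Uu Vv; have := WV _ _ Ww V'v.
    move: xy; rewrite !ltr_norml !ler_normr => + /andP[a1 a2] /andP[b1 b2].
    by case/orP => h; apply/orP; [left|right]; lra.
have /choice[D DP] := step.
pose N := fix N n := if n is n'.+1 then (D (N n')).1.2 else setT.
have oN n : open_nbhs x0 (N n).
  elim: n => [|n /DP[]//]; exact: open_nbhsT.
have NS n m : (n <= m)%N -> N m `<=` N n.
  elim: m => [|m IH]; first by rewrite leqn0 => /eqP ->.
  rewrite leq_eqVlt => /predU1P[->//|/IH nm]; apply: subset_trans nm.
  have [_ _ _ DN _] := DP _ (oN m).
  by move=> w Dw; apply: DN; right.
pose U n := (D (N n)).1.1.1 `*` (D (N n)).1.1.2.
have [|[p q] pq] := fcXY (fun n => (D (N n)).2) U.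
  move=> n; have [xU yV _ _ _] := DP _ (oN n).
  by exists ((D (N n)).1.1.1, (D (N n)).1.1.2).
have e4 : 0 < eps / 4 by lra.
have [P [Q [pP qQ PQ]]] := close (p, q) _ e4.
have PQn : nbhs (p, q) (P `*` Q) by exists (P, Q).
have [n _ [[u v] [[/= Pu Qv] [/= Uu Vv]]]] := pq _ PQn 0%N.
(* Starting at [n.+1] puts the [m]-th box over [N n.+1], which is the set W chosen with the [n]-th
   box. *)
have [m nm [[u' v'] [[/= Pu' Qv'] [/= Uu' Vv']]]] := pq _ PQn n.+1.
have [_ _ _ _ far] := DP _ (oN n).
have Wu' : (D (N n)).1.2 u'.
  apply: (NS n.+1 m nm); have [_ _ _ DN _] := DP _ (oN m).
  by apply: DN; left.
have := far _ _ _ Uu Vv Wu'; have := PQ _ _ Pu Qv; have := PQ _ _ Pu' Qv.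
rewrite !ltr_norml ler_normr => /andP[a1 a2] /andP[b1 b2].
by case/orP => h; lra.
Unshelve. all: by end_near. Qed.

(** * Corners [eSe] of a topological semigroup *)

Definition corner (S : semigroupType) (e : S) : set S :=
  [set x | e * x = x /\ x * e = x]%g.

Section TopologicalSemigroup.
Local Open Scope group_scope.
Variables (R : realType) (S : topologicalSemigroupType).

Lemma cvg_mulg (T : Type) (F : set_system T) (FF : Filter F) (f g : T -> S)
    (a b : S) :
  f @ F --> a -> g @ F --> b -> (fun t => f t * g t) @ F --> a * b.
Proof.
move=> fa gb; apply: (cvg_comp2 fa gb); exact: (mulg_continuous (a, b)).
Qed.

Lemma mulg_equicontinuous (f : S -> R) (x0 : S) (eps : R) :
  feebly_compact (S * S)%type -> continuous f -> (0 < eps)%R ->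
  \forall x \near x0, forall y, (`|f (x * y)%g - f (x0 * y)%g| < eps)%R.
Proof.
move=> fcS fc eps0.
apply: (@feebly_compact_equicontinuous _ _ _ (fun p => f (p.1 * p.2))) => //.
by move=> p; apply: continuous_comp; [exact: mulg_continuous | exact: fc].
Qed.

Lemma corner_dedekind_finite (e a b : S) :
  feebly_compact (S * S)%type -> hausdorff_space S ->
  completely_regular_space S -> e * e = e ->
  corner e a -> corner e b -> a * b = e -> b * a = e.
Proof.
move=> fcS hS crS ee [ea ae] [eb be] ab.
apply: contrapT => /eqP bae.
have [f [fc f0 fe1 fba]] : exists f : S -> R, [/\ continuous f,
    forall y, (0 <= f y)%R, f e = 1%R &
    forall y, ~ (~` [set b * a]) y -> f y = 0%R].
  apply: completely_regular_bump => //.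
  apply: open_nbhs_nbhs; split; last by move=> /= eba; rewrite eba eqxx in bae.
  apply: closed_openC.
  exact: accessible_closed_set1 (hausdorff_accessible hS) _.
have {}fba : f (b * a) = 0%R by apply: fba => /=; apply.
(* Powers of [a] and [b] in [eSe], with [e] as zeroth power because [S] has no unit. *)
pose A n := iter n ( *%g a) e; pose B n := iter n ( *%g^~ b) e.
(* Going from [A n] to [A m] through [s], [p] and [t] takes four such estimates, for a total below
   1/2. *)
pose N t := [set x | forall y, (`|f (x * y)%g - f (t * y)%g| < 1/8)%R].
have Nt t : nbhs t (N t) by apply: mulg_equicontinuous => //; lra.
have [p pP] := feebly_compact_fst e fcS (fun n => Nt (A n)).
have [n _ [s [ps ns]]] := pP _ (Nt p) 0%N.
(* Since [n < m], the power [c] below ends in a factor [a], which is what makes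
   [c * (b * a) = c]. *)
have [m nm [t [pt mt]]] := pP _ (Nt p) n.+1.
have AD i j : A (i + j)%N = A i * A j.
  elim: i => [|i IH]; last by rewrite addSn /A !iterS -/(A _) -/(A _) IH mulgA.
  by rewrite add0n; case: j => [|j] /=; rewrite ?ee// mulgA ea.
have AB i : A i * B i = e.
  elim: i => [|i IH] //=; rewrite -/(A i) -/(B i).
  by rewrite mulgA -(mulgA a) IH ae ab.
pose c := A (m - n)%N.
have cba : c * (b * a) = c.
  rewrite /c -(subnSK nm) -addn1 AD /A /= ae; set d := iter _ _ _.
  by rewrite -mulgA (mulgA a) ab ea.
have ce : c * e = c.
  rewrite /c -(subnSK nm) -addn1 AD /A /= ae; set d := iter _ _ _.
  by rewrite -mulgA ae.
have cE z : e * z = z -> A m * (B n * z) = c * z.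
  by move=> ez; rewrite -(subnK (ltnW nm)) AD -/c mulgA -(mulgA c) AB ce.
have close z : e * z = z -> (`|f z - f (c * z)%g| < 1/2)%R.
  move=> ez; have := ps (B n * z); have := ns (B n * z).
  have := pt (B n * z); have := mt (B n * z).
  rewrite cE// (mulgA (A n)) AB ez !ltr_norml.
  move=> /andP[? ?] /andP[? ?] /andP[? ?] /andP[? ?].
  by apply/andP; split; lra.
(* Both [f e = 1] and [f (b * a) = 0] lie within 1/2 of [f c], strictly. *)
have := close e ee; have /close : e * (b * a) = b * a by rewrite mulgA eb.
rewrite cba ce fba fe1 !ltr_norml => /andP[? ?] /andP[? ?].
suff : (1 < 1 :> R)%R by rewrite ltxx.
lra.
Qed.

Lemma corner_inv_continuous (e : S) (inv : S -> S) :
  feebly_compact (S * S)%type -> completely_regular_space S ->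
  (forall x, corner e x ->
     [/\ corner e (inv x), inv x * x = e & x * inv x = e]) ->
  continuous (fun x : corner e => inv (val x)).
Proof.
move=> fcS crS invP x0 O.
have [[eu ue] uz zu] := invP _ (set_valP x0).
set u := inv (val x0) in eu ue uz zu * => uO.
have [f [fc f0 fe1 fba]] := completely_regular_bump R crS uO.
(* Tested at [y = inv x], [g (x * y)] is [f u = 1] and [g (x0 * y)] is [f (inv x)], which would be 0
   if [inv x] were outside [O]. *)
pose g w := f (u * w).
have gc : continuous g.
  move=> w; apply: (@continuous_comp _ _ _ ( *%g u)); last exact: fc.
  by apply: cvg_mulg; [exact: cvg_cst | exact: cvg_id].
have vc : set_val x @[x --> x0] --> set_val x0 by exact: initial_continuous.
have nearx0 : nbhs x0 [set x : corner e |
    forall y, (`|g (set_val x * y)%g - g (set_val x0 * y)%g| < 1)%R] :=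
  vc _ (mulg_equicontinuous (set_val x0) fcS gc (@ltr01 R)).
change (nbhs x0 [set x : corner e | O (inv (val x))]).
apply: filterS nearx0 => x /= xP; apply: contrapT => ninv.
have [[ev ve] vx xv] := invP _ (set_valP x).
have := xP (inv (val x)).
rewrite /g set_valE xv ue fe1 mulgA uz ev fba//.
by rewrite subr0 normr1 ltxx.
Qed.
End TopologicalSemigroup.

Local Open Scope group_scope.

Lemma corner_mul (S : semigroupType) (e x y : S) :
  corner e x -> corner e y -> corner e (x * y).
Proof. by move=> [ex xe] [ey ye]; split; rewrite -?mulgA ?ye// mulgA ex. Qed.

Lemma continuous_pair (T X Y : topologicalType) (f : T -> X) (g : T -> Y) :
  continuous f -> continuous g -> continuous (fun t => (f t, g t)).
Proof. by move=> fc gc t; exact: cvg_pair (fc t) (gc t). Qed.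

Definition set_elt (T : Type) (A : set T) (x : T) (Ax : A x) : A :=
  exist _ x (mem_set Ax).

Lemma hausdorff_set_type (T : topologicalType) (A : set T) :
  hausdorff_space T -> hausdorff_space A.
Proof.
move=> hT x y xy; apply: val_inj; apply: hT => U V xU yV.
have ic := @initial_continuous A T set_val.
have [z [Uz Vz]] := xy _ _ (ic x U xU) (ic y V yV).
by exists (set_val z).
Qed.

(** * Inverses in the corners of a simple semigroup *)

Section SimpleSemigroup.
Variable S : semigroupType.
Hypothesis S_simple : simple_semigroup S.

(** [S a S] is a two-sided ideal, nonempty because it contains [a * a * a]. *)
Lemma simple_semigroup_factor (a s : S) : exists u v, s = u * a * v.
Proof.
suff IT : [set s | exists u v, s = u * a * v] = [set: S].
  by have : [set: S] s by []; rewrite -IT.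
apply: S_simple; split; first by exists (a * a * a), a, a.
move=> t _ [u [v ->]]; split; last by exists u, (v * t); rewrite mulgA.
by exists (t * u), v; rewrite !mulgA.
Qed.

(** Compressing the factors of [e = s * x * t] to the corner gives [s' * x * t' = e]. Dedekind
    finiteness, used twice, makes [t' * s'] a left and then a right inverse of [x]. Outside the
    corner [inv] is unconstrained. *)
Lemma simple_corner_inverse (e : S) :
  e * e = e ->
  (forall a b, corner e a -> corner e b -> a * b = e -> b * a = e) ->
  exists inv : S -> S, forall x, corner e x ->
    [/\ corner e (inv x), inv x * x = e & x * inv x = e].
Proof.
move=> ee dedekind.
suff /choice[inv invP] : forall x, exists y, corner e x ->
    [/\ corner e y, y * x = e & x * y = e] by exists inv.
move=> x; have [[ex xe]|] := pselect (corner e x); last by exists x.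
have [s [t est]] := simple_semigroup_factor x e.
pose s' := e * s * e; pose t' := e * t * e.
have Cs : corner e s' by rewrite /corner /s' /= -!mulgA ee !mulgA ee.
have Ct : corner e t' by rewrite /corner /t' /= -!mulgA ee !mulgA ee.
have {est}sxt : s' * x * t' = e.
  rewrite /s' /t' !mulgA -(mulgA (e * s) e x) ex -(mulgA (e * s) x e) xe.
  by rewrite -(mulgA e s x) -(mulgA e (s * x) t) -est !ee.
have tsx : t' * s' * x = e.
  by rewrite -mulgA; exact: dedekind (corner_mul Cs (conj ex xe)) Ct sxt.
exists (t' * s') => _; split=> //; first exact: corner_mul.
by apply: dedekind => //; exact: corner_mul.
Qed.

End SimpleSemigroup.

(* The proofs are arguments so that the group structure can be inferred from
   the type. *)
Definition corner_group (S : topologicalSemigroupType) (e : S) (inv : S -> S)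
    of e * e = e
    & (forall x, corner e x ->
        [/\ corner e (inv x), inv x * x = e & x * inv x = e])
    & continuous (fun x : corner e => inv (val x)) : Type := corner e.

(** * The topological group [eSe] *)

Section CornerGroup.
Variables (S : topologicalSemigroupType) (e : S) (inv : S -> S).
Hypothesis ee : e * e = e.
Hypothesis invP : forall x, corner e x ->
  [/\ corner e (inv x), inv x * x = e & x * inv x = e].
Hypothesis inv_continuous : continuous (fun x : corner e => inv (val x)).

Lemma corner_inv (x : S) : corner e x -> corner e (inv x).
Proof. by case/invP. Qed.

Lemma corner_one : corner e e. Proof. by []. Qed.

Local Notation G := (corner_group ee invP inv_continuous).

HB.instance Definition _ := Topological.copy G (corner e).

Definition corner_group_mul (x y : G) : G :=
  set_elt (corner_mul (set_valP x) (set_valP y)).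

Definition corner_group_inv (x : G) : G :=
  set_elt (corner_inv (set_valP x)).

Lemma corner_group_mulA : associative corner_group_mul.
Proof. by move=> x y z; apply: val_inj; rewrite /= mulgA. Qed.

Lemma corner_group_mul1g : left_id (set_elt corner_one) corner_group_mul.
Proof. by move=> x; apply: val_inj => /=; have [] := set_valP x. Qed.

Lemma corner_group_mulg1 : right_id (set_elt corner_one) corner_group_mul.
Proof. by move=> x; apply: val_inj => /=; have [] := set_valP x. Qed.

Lemma corner_group_mulVg :
  left_inverse (set_elt corner_one) corner_group_inv corner_group_mul.
Proof. by move=> x; apply: val_inj => /=; have [] := invP (set_valP x). Qed.

Lemma corner_group_mulgV :
  right_inverse (set_elt corner_one) corner_group_inv corner_group_mul.
Proof. by move=> x; apply: val_inj => /=; have [] := invP (set_valP x). Qed.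

HB.instance Definition _ := isGroup.Build G corner_group_mulA
  corner_group_mul1g corner_group_mulg1 corner_group_mulVg corner_group_mulgV.

Lemma corner_group_val_continuous : continuous (val : G -> S).
Proof. exact: (@initial_continuous (corner e) S set_val). Qed.

Lemma corner_group_mul_continuous :
  continuous (fun p : G * G => p.1 * p.2).
Proof.
apply: (@continuous_comp_initial _ _ _ (set_val : corner e -> S)) => p.
apply: cvg_mulg.
  apply: (@continuous_comp _ _ _ fst); first exact: cvg_fst.
  exact: corner_group_val_continuous.
apply: (@continuous_comp _ _ _ snd); first exact: cvg_snd.
exact: corner_group_val_continuous.
Qed.

HB.instance Definition _ :=
  isTopologicalSemigroup.Build G corner_group_mul_continuous.

Lemma corner_group_inv_continuous : continuous (fun x : G => x^-1).
Proof.
apply: (@continuous_comp_initial _ _ _ (set_val : corner e -> S)) => p.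
exact: inv_continuous.
Qed.

HB.instance Definition _ :=
  isTopologicalGroup.Build G corner_group_inv_continuous.

(** * Rees coordinates *)

(** In terms of Green's relations, [rees_left] and [rees_right] consist of the idempotents
    L-related, respectively R-related, to [e]. *)
Definition rees_left : set S := [set x | x * e = x /\ e * x = e].
Definition rees_right : set S := [set y | e * y = y /\ y * e = e].

Lemma rees_sandwich_corner (y : rees_right) (x : rees_left) :
  corner e (val y * val x).
Proof.
have [xe _] := set_valP x; have [ey _] := set_valP y.
by split; rewrite ?mulgA ?ey// -mulgA xe.
Qed.

Definition rees_sandwich (p : rees_right * rees_left) : G :=
  set_elt (rees_sandwich_corner p.1 p.2).

Lemma rees_sandwich_continuous : continuous rees_sandwich.
Proof.
apply: (@continuous_comp_initial _ _ _ (set_val : corner e -> S)) => p.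
apply: cvg_mulg.
  apply: (@continuous_comp _ _ _ fst); first exact: cvg_fst.
  exact: initial_continuous.
apply: (@continuous_comp _ _ _ snd); first exact: cvg_snd.
exact: initial_continuous.
Qed.

Definition rees_eval (p : rees rees_sandwich) : S :=
  val p.1.1 * val p.1.2 * val p.2.

Lemma rees_eval_morph : {morph rees_eval : p q / p * q}.
Proof. by move=> [[x h] y] [[x' h'] y']; rewrite /rees_eval /= !mulgA. Qed.

Lemma rees_eval_continuous : continuous rees_eval.
Proof.
move=> p; apply: cvg_mulg; first apply: cvg_mulg.
- apply: (@continuous_comp _ _ _ (fst \o fst)); last exact: initial_continuous.
  by apply: continuous_comp; exact: cvg_fst.
- apply: (@continuous_comp _ _ _ (snd \o fst)); last exact: initial_continuous.
  by apply: continuous_comp; [exact: cvg_fst | exact: cvg_snd].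
- apply: (@continuous_comp _ _ _ snd); last exact: initial_continuous.
  exact: cvg_snd.
Qed.

Lemma corner_sandwich (s : S) : corner e (e * s * e).
Proof. by split; rewrite ?mulgA ?ee// -mulgA ee. Qed.

Definition corner_part (s : S) : G := set_elt (corner_sandwich s).

Lemma rees_left_part (s : S) : rees_left (s * e * val (corner_part s)^-1).
Proof.
move: (invP (corner_sandwich s)) => /=; move: (inv _) => i [[ei ie] im mi].
by split; rewrite /= -?mulgA ?ie// -[RHS]mi !mulgA.
Qed.

Lemma rees_right_part (s : S) : rees_right (val (corner_part s)^-1 * e * s).
Proof.
move: (invP (corner_sandwich s)) => /=; move: (inv _) => i [[ei ie] im mi].
by split; rewrite /= ?mulgA ?ei// -[RHS]im !mulgA.
Qed.

Definition rees_coord (s : S) : rees rees_sandwich :=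
  (set_elt (rees_left_part s), corner_part s,
   set_elt (rees_right_part s)).

Lemma rees_evalK : cancel rees_eval rees_coord.
Proof.
move=> [[x h] y].
have [[[xe ex] [ey ye]] [eh he]] := (set_valP x, set_valP y, set_valP h).
(* As [e * x = e] and [y * e = e], compression by [e] recovers [h]; the outer coordinates follow by
   cancelling [h]. *)
have hE : e * rees_eval (x, h, y) * e = val h.
  by rewrite /rees_eval /= -!mulgA ye he mulgA ex eh.
have [[ei ie] im mi] := invP (set_valP h).
have rE : rees_eval (x, h, y) = val x * val h * val y by [].
move: (rees_eval _) hE rE => r hE rE.
rewrite /rees_coord; congr (_, _, _); apply: val_inj => //=; rewrite hE rE.
  by rewrite -!mulgA (mulgA (val y)) ye ei mi xe.
by rewrite !mulgA -(mulgA (inv _) e) ex ie im ey.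
Qed.

Lemma corner_part_continuous : continuous corner_part.
Proof.
apply: (@continuous_comp_initial _ _ _ (set_val : corner e -> S)) => s.
apply: cvg_mulg; last exact: cvg_cst.
by apply: cvg_mulg; [exact: cvg_cst | exact: cvg_id].
Qed.

Lemma rees_coord_continuous : continuous rees_coord.
Proof.
have ic : continuous (fun s => val (corner_part s)^-1).
  move=> s; apply: (@continuous_comp _ (corner e) _ corner_part
    (fun x => inv (val x))); last exact: inv_continuous.
  exact: corner_part_continuous.
apply: (@continuous_pair _ (rees_left * G)%type rees_right);
  first apply: continuous_pair.
- apply: (@continuous_comp_initial _ _ _ (set_val : rees_left -> S)) => t.
  apply: cvg_mulg; last exact: ic.
  by apply: cvg_mulg; [exact: cvg_id | exact: cvg_cst].
- exact: corner_part_continuous.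
- apply: (@continuous_comp_initial _ _ _ (set_val : rees_right -> S)) => t.
  apply: cvg_mulg; last exact: cvg_id.
  by apply: cvg_mulg; [exact: ic | exact: cvg_cst].
Qed.

(** It reduces to [s * e * i * s = s] with [i] the inverse of [ese]. If [s = u * e * v], then [ese]
    is the product of [eue] and [eve], so [eve * i] inverts [eue] and the inner factor
    [e * v * e * i * u * e] collapses to [e]. *)
Lemma rees_coordK : simple_semigroup S -> cancel rees_coord rees_eval.
Proof.
move=> simpS s; have [u [v suv]] := simple_semigroup_factor simpS e s.
have [[_ je] jp _] := invP (corner_sandwich u).
rewrite /rees_eval /=; move: (invP (corner_sandwich s)).
move: (inv (e * s * e)) => i [[ei ie] im mi].
have pqi : (e * u * e) * ((e * v * e) * i) = e.
  by rewrite !mulgA -(mulgA (e * u) e e) ee -[RHS]mi suv !mulgA.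
have qi : e * v * e * i = inv (e * u * e).
  by rewrite -[RHS]je -[X in _ = _ * X]pqi [RHS]mulgA jp !mulgA ee.
have qip : e * v * e * i * u * e = e.
  rewrite -[RHS]jp -qi; move: (e * v * e) => q.
  by rewrite !mulgA -(mulgA q i e) ie.
have -> : s * e * i * (e * s * e) * (i * e * s) = s * e * i * s.
  rewrite -(mulgA (s * e) i) im -(mulgA s e e) ee !mulgA.
  by rewrite -(mulgA (s * e) i e) ie.
have -> : s * e * i * s = u * (e * v * e * i * u * e) * v.
  by rewrite {1 2}suv !mulgA.
by rewrite qip -suv.
Qed.

Lemma topological_paragroup_of_corner_group :
  hausdorff_space S -> simple_semigroup S -> topological_paragroup S.
Proof.
move=> hS simpS; exists rees_left, rees_right, G, rees_sandwich.
split; try exact: hausdorff_set_type; first exact: rees_sandwich_continuous.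
exists rees_coord, rees_eval; split.
- move=> a b; rewrite -{1}(rees_coordK simpS a) -{1}(rees_coordK simpS b).
  by rewrite -rees_eval_morph rees_evalK.
- exact: rees_coordK.
- exact: rees_evalK.
- exact: rees_coord_continuous.
- exact: rees_eval_continuous.
Qed.

End CornerGroup.

(** * Simplicity of Rees products and the equivalence *)

(** The inner indices of [u] and [v] are free; taking them from [p] gives the middle entry [k],
    which a group inverse cancels. Every ideal of a Rees product is therefore everything. *)
Lemma rees_factor (X Y : choiceType) (H : groupType) (sigma : Y * X -> H)
    (p q : rees sigma) :
  exists u v : rees sigma, q = u * p * v.
Proof.
case: p q => [[x h] y] [[x' h'] y'].
pose k := sigma (y, x) * h * sigma (y, x).
exists ((x', 1, y) : rees sigma), ((x, k^-1 * h', y') : rees sigma).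
by congr (_, _, _); rewrite !mul1g -/k mulVKg.
Qed.

Theorem theorem11 (R : realType) (S : topologicalSemigroupType)
    (S_nonempty : [set: S] !=set0)
    (S_hausdorff : hausdorff_space S)
    (SxS_pseudocompact : pseudocompact_space R (S * S)%type) :
  topological_paragroup S <->
  simple_semigroup S /\ exists e : S, idempotent_element e.
Proof.
split=> [[X [Y [H [sigma [_ _ _ _ [f [g [fM fK gK _ _]]]]]]]]|[simpS [e ee]]].
  have gM : {morph g : p q / p * q}.
    by move=> p q; apply: (can_inj fK); rewrite fM !gK.
  split.
    move=> I [[a Ia] idI]; apply/seteqP; split => // s _.
    have [u [v]] := rees_factor (f a) (f s).
    move=> /(congr1 g); rewrite !gM !fK => ->.
    by apply: (idI _ _ _).2; apply: (idI _ _ Ia).1.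
  have [s _] := S_nonempty; move: (f s) => [[x h] y].
  (* Squaring inserts [sigma (y, x)] between two copies of its inverse. *)
  exists (g ((x, (sigma (y, x))^-1, y) : rees sigma)).
  rewrite /idempotent_element -gM; congr g; congr (_, _, _).
  by rewrite mulVg mul1g.
have fcS := pseudocompact_feebly_compact SxS_pseudocompact.
have [[_ crSS] _] := SxS_pseudocompact.
have crS : completely_regular_space S.
  (* Only the square is assumed Tychonoff; [S] is viewed as the slice through [e]. *)
  exact: (@completely_regular_left_factor R _ _ e crSS).
have [inv invP] := simple_corner_inverse simpS ee
  (fun a b => corner_dedekind_finite R fcS S_hausdorff crS ee).
apply: (topological_paragroup_of_corner_group ee invP) => //.
exact: (corner_inv_continuous R fcS crS invP).
Qed.
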